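(* Let $(I,C)$ be a hypergraph of agents and contracts in which every agent $i\in I$ has a non-empty-valued Plott choice function $f_i$ on $C(i)$. Then a meta-stable contract system $S\subseteq C$ exists.
   Context: Finite agents $I$, finite contracts $C$, each $c\in C$ with nonempty participant set $P(c)\subseteq I$; $S(i)=\{s\in S:i\in P(s)\}$. A choice function $f$ on finite $X$ satisfies $f(A)\subseteq A$; Plott means $f(A\cup B)=f(f(A)\cup B)$ for all $A,B$; non-empty-valued means $f(A)\ne\emptyset$ for $A\ne\emptyset$. An element $d$ dominates a set $A$ relative to $f$ if $A=\emptyset$ or some $a\in A$ has $a\notin f(\{a,d\})$. A contract $d$ dominates $S\subseteq C$ if for every $i\in P(d)$, $d$ dominates $S(i)$ relative to $f_i$. $S$ is meta-stable if no contract in $C$ dominates $S$. *)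

(* Defs.v *)
From mathcomp Require Import all_boot.
Set Implicit Arguments.
Unset Strict Implicit.
Unset Printing Implicit Defensive.

(* Choice functions on a finite ground set X : {set T} are represented by total
   maps {set T} -> {set T}; only their values on subsets of X are constrained
   or used. *)
Section ChoiceFunctions.
Variable T : finType.
Implicit Types (X A B : {set T}) (f : {set T} -> {set T}).

Definition choice_function X f : Prop :=
  forall A, A \subset X -> f A \subset A.

Definition plott X f : Prop :=
  forall A B, A \subset X -> B \subset X -> f (A :|: B) = f (f A :|: B).

Definition nonempty_valued X f : Prop :=
  forall A, A \subset X -> A != set0 -> f A != set0.

Definition elt_dominates f (d : T) A : Prop :=
  A = set0 \/ exists2 a, a \in A & a \notin f [set a; d].

End ChoiceFunctions.

Section Contracts.
Variables (I C : finType) (P : C -> {set I}).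
Implicit Types (i : I) (d : C) (S : {set C}) (f : I -> {set C} -> {set C}).

Definition contracts_of S i : {set C} := [set s in S | i \in P s].

Definition contract_dominates f d S : Prop :=
  forall i, i \in P d -> elt_dominates (f i) d (contracts_of S i).

Definition meta_stable f S : Prop :=
  forall d, ~ contract_dominates f d S.

End Contracts.

(* Main.v *)
Require Import Defs.
From mathcomp Require Import all_boot.
Set Implicit Arguments.
Unset Strict Implicit.
Unset Printing Implicit Defensive.

(** For a Plott function, "[a] is not chosen from [{a, d}]" is a strict partial
    order on the contracts of the agent, so each agent may be given a linear
    order extending it. Add for each agent [i] a slack contract ranked lowest by
    [i] and above all genuine contracts by the others, and let [i] rank the
    contracts not involving it above its own. Call a set of contracts dominating
    if every contract is, for some agent, weakly below all of it. As in Scarf's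
    lemma, the dominating sets form a triangulated simplex: a dominating set with
    [#|I| - 1] elements has exactly two dominating one-point extensions, or one
    if it consists of slacks. Label a contract by any of its participants and a
    slack by its agent; Sperner's parity argument gives a dominating set carrying
    all labels. As every agent has an own contract or slack in this set, the
    agent witnessing that [d] lies below it participates in [d], and the genuine
    contracts in the set form a meta-stable system. *)

(** * Dominating sets and their row minima *)

Section ScarfSperner.
Variables (J X : finType) (r : J -> X -> nat).
Hypothesis r_inj : forall j, injective (r j).
Implicit Types (F S : {set X}) (i j k : J) (x y d : X).

Definition dominating S :=
  [forall d, exists i, forall s in S, r i d <= r i s].

Lemma dominatingP S :
  reflect (forall d, exists i, forall s, s \in S -> r i d <= r i s)
          (dominating S).
Proof.
apply: (iffP forallP) => H d.
  by have /existsP[i /forall_inP Hi] := H d; exists i.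
by have [i Hi] := H d; apply/existsP; exists i; apply/forall_inP.
Qed.

Lemma dominatingS F S : F \subset S -> dominating S -> dominating F.
Proof.
move=> /subsetP sFS /dominatingP domS; apply/dominatingP => d.
by have [i Hi] := domS d; exists i => s /sFS; apply: Hi.
Qed.

Definition is_row_min S i x := (x \in S) /\ forall s, s \in S -> r i x <= r i s.

Lemma row_min_uniq S i x y : is_row_min S i x -> is_row_min S i y -> x = y.
Proof.
move=> [xS xm] [yS ym]; apply: (@r_inj i); apply/eqP.
by rewrite eqn_leq xm // ym.
Qed.

Lemma row_min_ex S (S0 : S != set0) : exists m : J -> X, forall i, is_row_min S i (m i).
Proof.
have [x0 x0S] := set0Pn _ S0.
exists (fun i => [arg min_(x < x0 in S) r i x]) => i.
by case: arg_minnP => // x xS xm; split.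
Qed.

(** Domination applied to an element of [S] itself puts it at the bottom of some row. *)
Lemma row_min_onto S m : dominating S -> (forall i, is_row_min S i (m i)) ->
  m @: [set: J] = S.
Proof.
move=> /dominatingP domS mP; apply/setP => x; apply/imsetP/idP.
  by move=> [i _ ->]; have [] := mP i.
move=> xS; have [i Hi] := domS x; exists i => //.
by apply: (@row_min_uniq S i).
Qed.

(** * One-point extensions of a facet *)

Section Facet.
Variables (F : {set X}) (m : J -> X).
Hypotheses (domF : dominating F) (cardF : #|F|.+1 = #|J|).
Hypothesis mP : forall i, is_row_min F i (m i).

(* The vertices that can be added to the facet [F] as its new minimum in row [i]
   while keeping the minima of all other rows. *)
Definition above i := [set d | [forall k, (k != i) ==> (r k (m k) < r k d)]].

Lemma aboveP i d :
  reflect (forall k, k != i -> r k (m k) < r k d) (d \in above i).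
Proof.
rewrite inE; apply: (iffP forallP) => H k; first by move: (H k) => /implyP.
exact/implyP/H.
Qed.

Lemma above_row_le i d : d \in above i -> r i d <= r i (m i).
Proof.
move=> /aboveP dA; have [k Hk] := dominatingP _ domF d.
have le_k := Hk _ (mP k).1.
by case: (eqVneq k i) le_k => [-> //|/dA]; rewrite ltnNge => /negbTE ->.
Qed.

Lemma facet_twins : exists i j, [/\ i != j, m i = m j,
  m @: [set~ i] = F & m @: [set~ j] = F].
Proof.
have imF := row_min_onto domF mP.
have : ~~ [forall i, forall j, (m i == m j) ==> (i == j)].
  apply/negP => /forallP H.
  have minj : injective m.
    by move=> i j /eqP e; apply/eqP; move/forallP: (H i) => /(_ j) /implyP; apply.
  by move: cardF; rewrite -imF card_imset // cardsT => /esym /n_Sn.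
rewrite negb_forall => /existsP[i]; rewrite negb_forall => /existsP[j].
rewrite negb_imply => /andP[/eqP mij nij].
have imD a b : a != b -> m a = m b -> m @: [set~ a] = F.
  move=> nab mab; rewrite -imF; apply/setP => x; apply/imsetP/imsetP.
    by move=> [k _ ->]; exists k.
  move=> [k _ ->]; case: (eqVneq k a) => [->|nka].
    by exists b; rewrite // !inE eq_sym.
  by exists k; rewrite // !inE.
exists i, j; split=> //; first exact: imD mij.
by apply: imD (esym mij); rewrite eq_sym.
Qed.

Variables (i j : J).
Hypotheses (nij : i != j) (mij : m i = m j).
Hypotheses (imi : m @: [set~ i] = F) (imj : m @: [set~ j] = F).

Lemma aboveNF a x : m @: [set~ a] = F -> x \in above a -> x \notin F.
Proof.
move=> ima /aboveP xA; apply/negP; rewrite -ima => /imsetP[k].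
by rewrite !inE => /xA H e; rewrite e ltnn in H.
Qed.

Definition is_top a x := (x \in above a) && [forall y in above a, r a y <= r a x].

(** A [d] in [above a] lies below [x] and all of [F] in row [a]. Any other [d] is at most the
    minimum of some row [k != a], and [x] does not lower that minimum. *)
Lemma is_top_dominating a x : is_top a x -> dominating (x |: F).
Proof.
move=> /andP[/aboveP xA /forall_inP xtop]; apply/dominatingP => d.
have [dA|] := boolP (d \in above a).
  exists a => s; rewrite !inE => /predU1P[->|sF]; first exact: xtop.
  exact: leq_trans (above_row_le dA) ((mP a).2 _ sF).
rewrite inE negb_forall => /existsP[k]; rewrite negb_imply -leqNgt => /andP[ka dk].
exists k => s; rewrite !inE => /predU1P[->|sF].
  exact: leq_trans dk (ltnW (xA _ ka)).
exact: leq_trans dk ((mP k).2 _ sF).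
Qed.

(** The enlarged set has as many elements as there are rows, so its row minima are distinct. Hence
    [x] is the minimum of a single row, and this is [i] or [j], since otherwise both would keep
    their common minimum. *)
Lemma dominating_is_top x : x \notin F -> dominating (x |: F) ->
  is_top i x || is_top j x.
Proof.
move=> xF domx.
have [M MP] : exists M : J -> X, forall k, is_row_min (x |: F) k (M k).
  by apply: row_min_ex; apply/set0Pn; exists x; rewrite setU11.
have imM := row_min_onto domx MP.
have Minj : injective M.
  have : #|M @: [set: J]| == #|[set: J]| by rewrite imM cardsU1 xF cardsT -cardF.
  by move/imset_injP => H a b; apply: H; rewrite inE.
have Mm k : M k != x -> M k = m k.
  move=> nMx; apply: (@row_min_uniq F k) => //; split.
    by have := (MP k).1; rewrite !inE (negbTE nMx).
  by move=> s sF; apply: (MP k).2; rewrite !inE sF orbT.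
have [k xMk] : exists k, x = M k.
  have : x \in M @: [set: J] by rewrite imM setU11.
  by case/imsetP => k _ ->; exists k.
have topk : is_top k x.
  have xA : forall l, l != k -> r l (m l) < r l x.
    move=> l lk; have nMx : M l != x by rewrite xMk (inj_eq Minj).
    rewrite ltn_neqAle -(Mm _ nMx) (inj_eq (@r_inj l)) nMx.
    by apply: (MP l).2; rewrite setU11.
  apply/andP; split; first exact/aboveP.
  apply/forall_inP => y /aboveP yA.
  have [l Hl] := dominatingP _ domx y.
  case: (eqVneq l k) => [<-|/yA]; first by apply: Hl; rewrite setU11.
  by rewrite ltnNge Hl // !inE (mP l).1 orbT.
have [ki|nki] := eqVneq k i; first by rewrite -ki topk.
have [kj|nkj] := eqVneq k j; first by rewrite -kj topk orbT.
have Mi : M i = m i by apply: Mm; rewrite xMk (inj_eq Minj) eq_sym.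
have Mj : M j = m j by apply: Mm; rewrite xMk (inj_eq Minj) eq_sym.
by move/eqP: nij; case; apply: Minj; rewrite Mi Mj.
Qed.

Lemma card_is_top a : #|[set x | is_top a x]| = (above a != set0).
Proof.
have [A0|/set0Pn[x0 x0A]] /= := eqVneq (above a) set0; last first.
  pose t := [arg max_(x > x0 in above a) r a x].
  have [tA tm] : t \in above a /\ forall y, y \in above a -> r a y <= r a t.
    by rewrite /t; case: arg_maxnP.
  rewrite (_ : [set x | is_top a x] = [set t]) ?cards1 //.
  apply/setP => x; rewrite !inE; apply/andP/eqP => [[xA /forall_inP xm]|->].
    by apply: (@r_inj a); apply/eqP; rewrite eqn_leq tm // xm.
  by split=> //; apply/forall_inP.
by apply/eqP; rewrite cards_eq0; apply/eqP/setP => x; rewrite !inE /is_top A0 inE.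
Qed.

Lemma card_extensions :
  #|[set x | (x \notin F) && dominating (x |: F)]|
    = (above i != set0) + (above j != set0).
Proof.
rewrite -!card_is_top.
have -> : [set x | (x \notin F) && dominating (x |: F)]
       = [set x | is_top i x] :|: [set x | is_top j x].
  apply/setP => x; rewrite !inE; apply/andP/idP => [[]|].
    exact: dominating_is_top.
  case/orP=> xt; split; try exact: is_top_dominating xt.
    by case/andP: xt => /(aboveNF imi).
  by case/andP: xt => /(aboveNF imj).
rewrite cardsU (_ : _ :&: _ = set0) ?cards0 ?subn0 //.
(* A common member would exceed the minimum of [F] in every row, although [F] is dominating. *)
apply/setP => x; rewrite !inE; apply/negP => /andP[/andP[xi _] /andP[xj _]].
have [k Hk] := dominatingP _ domF x.
have := Hk _ (mP k).1; apply/negP; rewrite -ltnNge.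
have [ki|] := eqVneq k i; last by move/aboveP: xi; apply.
by move/aboveP: xj; apply; rewrite ki.
Qed.

End Facet.

(** * Slacks and the boundary facet *)

Variable e : J -> X.
Hypothesis e_low : forall j x, x != e j -> r j (e j) < r j x.
Hypothesis e_high : forall j k x, k != j -> x \notin codom e -> r j x < r j (e k).

(** Outside its own row a slack exceeds the non-slack [y] of [F], hence the row minimum. So both
    twin rows admit an extension. *)
Lemma card_extensions_inner F : dominating F -> #|F|.+1 = #|J| ->
  ~~ (F \subset codom e) ->
  #|[set x | (x \notin F) && dominating (x |: F)]| = 2.
Proof.
move=> domF cardF /subsetPn[y yF ye].
have F0 : F != set0 by apply/set0Pn; exists y.
have [m mP] := row_min_ex F0.
have [i [j [nij mij imi imj]]] := facet_twins domF cardF mP.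
rewrite (card_extensions domF cardF mP nij mij imi imj).
have above_e a : e a \in above m a.
  apply/aboveP => k ka; apply: leq_ltn_trans ((mP k).2 _ yF) _.
  by apply: e_high; rewrite // eq_sym.
have nz a : above m a != set0 by apply/set0Pn; exists (e a).
by rewrite !nz.
Qed.

Hypothesis e_inj : injective e.
Variable k0 : J.
Let F0 := e @: [set~ k0].

(** Each slack in [F0] is lowest in its own row, so only row [k0] can witness domination for
    elements outside [F0]. The added vertex must be the largest of these in row [k0]. *)
Lemma card_extensions_boundary :
  #|[set x | (x \notin F0) && dominating (x |: F0)]| = 1.
Proof.
have ek0 : e k0 \notin F0 by rewrite mem_imset // !inE eqxx.
pose t := [arg max_(x > e k0 | x \notin F0) r k0 x].
have [tF tm] : t \notin F0 /\ forall y, y \notin F0 -> r k0 y <= r k0 t.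
  by rewrite /t; case: arg_maxnP.
rewrite (_ : [set x | _] = [set t]) ?cards1 //.
apply/setP => x; rewrite !inE; apply/andP/eqP => [[xF /dominatingP domx]|->].
  apply: (@r_inj k0); apply/eqP; rewrite eqn_leq tm //.
  have [k Hk] := domx t.
  have [<-|nk] := eqVneq k k0; first by apply: Hk; rewrite setU11.
  have ekF : e k \in F0 by rewrite mem_imset // !inE.
  have tk : t != e k by apply: contraNneq tF => ->.
  by have := e_low tk; rewrite ltnNge Hk // !inE ekF orbT.
split=> //; apply/dominatingP => d.
have [/imsetP[k _ ->]|dF] := boolP (d \in F0).
  by exists k => s _; have [->//|/e_low/ltnW] := eqVneq s (e k).
exists k0 => s; rewrite !inE => /predU1P[->|]; first exact: tm.
case/imsetP=> k; rewrite !inE => nk ->; apply: ltnW.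
have [/codomP[l dl]|nd] := boolP (d \in codom e); last exact: e_high.
have -> : d = e k0.
  by rewrite dl; congr e; apply/eqP; apply: contraNT dF => nl; rewrite dl mem_imset // !inE.
by apply: e_low; rewrite (inj_eq e_inj).
Qed.

(** * Sperner labelling and parity *)

Variable lab : X -> J.
Hypothesis lab_e : forall j, lab (e j) = j.

Definition door F := [&& dominating F, lab @: F == [set~ k0] & #|F|.+1 == #|J|].

Lemma door_inj F : door F -> {in F &, injective lab}.
Proof.
case/and3P=> _ /eqP imF /eqP cardF; apply/imset_injP.
by rewrite imF cardsC1 -cardF.
Qed.

Lemma door_boundary F : door F -> F \subset codom e -> F = F0.
Proof.
case/and3P=> _ /eqP imF _ /subsetP sF; apply/setP => x; apply/idP/imsetP.
  move=> xF; have /codomP[k xk] := sF _ xF; exists k => //.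
  by rewrite -imF -(lab_e k) -xk imset_f.
move=> [k]; rewrite -imF => /imsetP[y yF ->] ->.
by have /codomP[l yl] := sF _ yF; rewrite yl lab_e -yl.
Qed.

Lemma door_F0 : door F0.
Proof.
apply/and3P; split.
- have /set0Pn[x] : [set x | (x \notin F0) && dominating (x |: F0)] != set0.
    by rewrite -card_gt0 card_extensions_boundary.
  by rewrite inE => /andP[_]; apply: dominatingS; apply: subsetUr.
- apply/eqP; rewrite -imset_comp; apply/setP => k.
  apply/imsetP/idP => [[l lk ->]|kk]; first by rewrite /= lab_e.
  by exists k; rewrite //= lab_e.
by rewrite card_imset // cardsC1 prednK //; apply/card_gt0P; exists k0.
Qed.

(* Removing a vertex from a non-rainbow simplex leaves a door only when that
   vertex is one of the two sharing a label. *)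
Lemma card_doors_even S : dominating S -> lab @: S != [set: J] ->
  ~~ odd #|[set x in S | door (S :\ x)]|.
Proof.
move=> domS nrb.
have [->|/set0Pn[x]] := eqVneq [set x in S | door (S :\ x)] set0.
  by rewrite cards0.
rewrite inE => /andP[xS dx]; have /and3P[domx /eqP imx cardx] := dx.
have labx : lab x != k0.
  apply: contraNneq nrb => lx; rewrite -(setD1K xS) imsetU1 imx lx.
  by apply/eqP/setP => k; rewrite !inE orbN.
have /imsetP[y yS lxy] : lab x \in lab @: (S :\ x) by rewrite imx !inE.
have inj := door_inj dx.
move: (yS); rewrite !inE => /andP[nyx yS'].
have dy : door (S :\ y).
  have sub : lab @: (S :\ y) = [set~ k0].
    rewrite -imx; apply/setP => k; apply/imsetP/imsetP => [] [z].
      rewrite !inE => /andP[nzy zS] ->; have [->|nzx] := eqVneq z x.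
        by exists y.
      by exists z; rewrite // !inE nzx.
    rewrite !inE => /andP[nzx zS] ->; have [->|nzy] := eqVneq z y.
      by exists x; rewrite // !inE eq_sym nyx.
    by exists z; rewrite // !inE nzy.
  apply/and3P; split; last 1 first.
  - have := cardsD1 y S; rewrite (cardsD1 x S) xS yS' !add1n => <-.
    exact: cardx.
  - exact: dominatingS (subsetDl _ _) domS.
  - exact/eqP.
rewrite (_ : [set x in S | _] = [set x; y]) ?cards2 1?eq_sym ?nyx //.
apply/setP => z; rewrite !inE; apply/andP/orP => [[zS dz]|[] /eqP ->] //.
have [->|nzx] := eqVneq z x; [by left|right].
(* The label of [z] recurs at some other [w] in [S]. Injectivity of labels off [x] forces [w = x],
   so [z] has the label of [y] and equals it. *)
have zSx : z \in S :\ x by rewrite !inE nzx.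
have /imsetP[w] : lab z \in lab @: (S :\ z).
  by have /and3P[_ /eqP -> _] := dz; rewrite -imx imset_f.
rewrite !inE => /andP[nwz wS] lzw; have [wx|nwx] := eqVneq w x.
  by apply/eqP; apply: inj => //; rewrite lzw wx.
by case/eqP: nwz; apply: inj; rewrite // !inE nwx.
Qed.

Lemma even_sum (T : finType) (Q : pred T) (g : T -> nat) :
  (forall t, Q t -> ~~ odd (g t)) -> ~~ odd (\sum_(t | Q t) g t).
Proof.
move=> Hg; apply: (big_ind (fun n => ~~ odd n)) => // a b.
by rewrite oddD => /negbTE -> /negbTE ->.
Qed.

(** Count pairs of a door and a dominating extension. By doors the count is odd: one for [F0], two
    for every other. By extended sets it would be even if none were rainbow. *)
Lemma rainbow_dominating : exists2 S, dominating S & lab @: S = [set: J].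
Proof.
suff /existsP[S /andP[domS /eqP rb]] :
  [exists S, dominating S && (lab @: S == [set: J])] by exists S.
apply: contraT => /existsPn nrb.
pose N := \sum_(F | door F) \sum_(x | (x \notin F) && dominating (x |: F)) 1.
have oddN : odd N.
  rewrite /N (bigD1 F0) ?door_F0 //= oddD sum1dep_card card_extensions_boundary /=.
  apply: even_sum => F /andP[dF nF0].
  rewrite sum1dep_card card_extensions_inner //; try by case/and3P: dF => ? _ /eqP.
  by apply: contra nF0 => /(door_boundary dF) ->.
suff : ~~ odd N by rewrite oddN.
have -> : N = \sum_(S | dominating S) \sum_(x | (x \in S) && door (S :\ x)) 1.
  rewrite /N (exchange_big_dep xpredT) //= [RHS](exchange_big_dep xpredT) //=.
  apply: eq_bigr => x _.
  rewrite (reindex_onto (fun S => S :\ x) (fun F => x |: F)); last first.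
    by move=> F /and3P[_ xF _]; rewrite setU1K.
  apply: eq_bigl => S; rewrite setD11 /=.
  have [xS|xS] := boolP (x \in S); first by rewrite setD1K // eqxx andbT andbC.
  rewrite andbF; apply/negP => /andP[_ /eqP e1].
  by move: xS; rewrite -e1 setU11.
apply: even_sum => S domS; rewrite sum1dep_card; apply: card_doors_even => //.
by move: (nrb S); rewrite domS.
Qed.

End ScarfSperner.

(** * The strict order given by binary choices *)

Section BinaryChoice.
Variables (T : finType) (X : {set T}) (f : {set T} -> {set T}).
Hypotheses (f_choice : choice_function X f) (f_plott : plott X f)
  (f_nonempty : nonempty_valued X f).

Definition beaten a d := a \notin f [set a; d].

Lemma choice_beaten a d : a \in X -> d \in X -> beaten a d ->
  f [set a; d] = [set d].
Proof.
move=> aX dX nad; have sX : [set a; d] \subset X by rewrite subUset !sub1set aX.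
have /subsetP sf := f_choice sX.
have /set0Pn[b bf] : f [set a; d] != set0.
  by apply: f_nonempty => //; apply/set0Pn; exists a; rewrite !inE eqxx.
have fd c : c \in f [set a; d] -> c = d.
  by move=> cf; have /set2P[ca|//] := sf _ cf; move: nad; rewrite /beaten -{1}ca cf.
by apply/setP => c; rewrite inE; apply/idP/eqP => [/fd //|->]; rewrite -{1}(fd _ bf).
Qed.

Lemma beaten_irr a : a \in X -> ~~ beaten a a.
Proof.
move=> aX; apply/negP => naa; have := choice_beaten aX aX naa.
by move=> e; move: naa; rewrite /beaten e set11.
Qed.

Lemma beaten_trans b a d : a \in X -> b \in X -> d \in X ->
  beaten a b -> beaten b d -> beaten a d.
Proof.
move=> aX bX dX nab nbd.
(* The Plott identity evaluates the choice from [a], [b], [d] in two ways, reducing first the pair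
   [a], [b] or first the pair [b], [d]. *)
have e1 : f ([set a; b] :|: [set d]) = [set d].
  rewrite f_plott ?subUset ?sub1set ?aX ?bX ?dX // (choice_beaten aX bX nab).
  exact: choice_beaten.
have e2 : f ([set b; d] :|: [set a]) = f [set a; d].
  rewrite f_plott ?subUset ?sub1set ?aX ?bX ?dX // (choice_beaten bX dX nbd).
  by rewrite setUC.
have e3 : [set a; b] :|: [set d] = [set b; d] :|: [set a].
  by rewrite -setUA setUC.
apply/negP => ad; move: nab.
have da : a = d by apply/set1P; rewrite -e1 e3 e2.
move: nbd; rewrite -da => nba nab.
have := choice_beaten aX bX nab; rewrite setUC (choice_beaten bX aX nba).
by move/set1_inj => e; move: nab; rewrite -e (negbTE (beaten_irr aX)).
Qed.

(** A numerical weight that is strictly monotone for the beating order, used to extend it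
    linearly. *)
Definition beat_rank d := #|[set a in X | beaten a d]|.

Lemma beat_rank_lt a d : a \in X -> d \in X -> beaten a d ->
  beat_rank a < beat_rank d.
Proof.
move=> aX dX nad; apply: proper_card; apply/properP; split.
  by apply/subsetP => b; rewrite !inE => /andP[bX nba]; rewrite bX (beaten_trans bX aX).
by exists a; rewrite !inE aX // (negbTE (beaten_irr aX)).
Qed.

End BinaryChoice.

(** * Linear rankings and the meta-stable system *)

Lemma tie_break_inj (X : finType) (w : X -> nat) :
  injective (fun x => w x * #|X| + enum_rank x).
Proof.
move=> x y /(congr1 (modn^~ #|X|)).
by rewrite !modnMDl !modn_small ?ltn_ord // => /ord_inj /enum_rank_inj.
Qed.

Lemma tie_break_lt (X : finType) (w : X -> nat) x y : w x < w y ->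
  w x * #|X| + enum_rank x < w y * #|X| + enum_rank y.
Proof.
move=> wxy; apply: (@leq_trans ((w x).+1 * #|X|)).
  by rewrite mulSn addnC ltn_add2r ltn_ord.
by apply: leq_trans (leq_addr _ _); rewrite leq_mul2r wxy orbT.
Qed.

Theorem theorem5p1 (I C : finType) (P : C -> {set I})
    (f : I -> {set C} -> {set C})
    (P_nonempty : forall c : C, P c != set0)
    (f_choice : forall i : I, choice_function (contracts_of P [set: C] i) (f i))
    (f_plott : forall i : I, plott (contracts_of P [set: C] i) (f i))
    (f_nonempty : forall i : I, nonempty_valued (contracts_of P [set: C] i) (f i)) :
  exists S : {set C}, meta_stable P f S.
Proof.
have [k0 _|I0] := pickP (@predT I); last first.
  by exists set0 => d _; have /set0Pn[i] := P_nonempty d; have := I0 i.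
have [own ownP] : exists own : C -> I, forall c, own c \in P c.
  exists (fun c => odflt k0 [pick i in P c]) => c; case: pickP => //= H.
  by have /set0Pn[i] := P_nonempty c; rewrite H.
have inX i c : (c \in contracts_of P [set: C] i) = (i \in P c) by rewrite !inE.
pose rk i := beat_rank (contracts_of P [set: C] i) (f i).
pose X := (I + C)%type.
(* Four layers: own slack at 0, own contracts from 1 to [#|C|.+1] since [rk] is at most [#|C|], then
   foreign contracts, then foreign slacks. *)
pose w i (x : X) := match x with
  | inl j => if j == i then 0 else #|C|.+3
  | inr c => if i \in P c then (rk i c).+1 else #|C|.+2
  end.
have rk_le i c : (rk i c).+1 < #|C|.+2 by rewrite !ltnS max_card.
(* Lexicographic order: [enum_rank] stays below [#|{: X}|], so it only breaks ties. *)
pose r i (x : X) := w i x * #|{: X}| + enum_rank x.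
have r_inj i : injective (r i) := @tie_break_inj _ (w i).
have r_lt i x y : w i x < w i y -> r i x < r i y := @tie_break_lt _ (w i) x y.
have e_low j x : x != inl j -> r j (inl j) < r j x.
  move=> nx; apply: r_lt; rewrite /= eqxx; case: x nx => [k|c] /= nx.
    by have [kj|//] := eqVneq k j; rewrite kj eqxx in nx.
  by case: ifP.
have e_high j k (x : X) : k != j -> x \notin codom (@inl I C) ->
    r j x < r j (inl k).
  move=> /negbTE nkj; case: x => [l|c] nx; first by rewrite codom_f in nx.
  by apply: r_lt; rewrite /= nkj; case: ifP => // _; apply: leqW (rk_le _ _).
pose lab (x : X) := match x with inl j => j | inr c => own c end.
have [S /dominatingP domS rb] :=
  @rainbow_dominating _ _ r r_inj _ e_low e_high (fun _ _ => @inl_inj _ _ _ _) k0 lab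
    (fun j => erefl).
exists [set c | inr c \in S] => d dd; have [i di] := domS (inr d).
have /imsetP[[j|c] xS /= ix] : i \in lab @: S by rewrite rb.
  (* The slack of [i] cannot be in [S]: it ranks strictly below [d] for [i]. *)
  by have := di _ xS; rewrite -ix leqNgt e_low.
have iPc : i \in P c by rewrite ix ownP.
have iPd : i \in P d.
  (* A contract foreign to [i] would rank above [c]. *)
  apply: contraT => nd; have := di _ xS; rewrite leqNgt r_lt //= iPc (negbTE nd).
  exact: rk_le.
have [Si0|[a]] := dd i iPd.
  by have := in_set0 c; rewrite -Si0 !inE xS iPc.
(* If [d] beats [a], it ranks strictly above [a] for [i], against the choice of [i]. *)
rewrite !inE => /andP[aS iPa] nad; have := di _ aS.
rewrite leqNgt r_lt //= iPa iPd ltnS.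
by apply: beat_rank_lt => //; rewrite inX.
Qed.
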